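(* Let $\dot x=f(t,x)$ be a dynamical system on $\mathbb{R}^n$ that is monotone on a convex forward invariant set $\mathcal{C}\subseteq\mathbb{R}^n$, and let $\|\cdot\|$ be a norm on $\mathbb{R}^n$ with associated weak pairing $\llbracket\cdot,\cdot\rrbracket$ satisfying Deimling's inequality. Let $b\in\mathbb{R}$. If $\|\cdot\|$ is monotonic, then the following statements are equivalent: (i) $\mu^{+}(Df(t,x))\le b$ for every $(t,x)\in\mathbb{R}_{\ge0}\times\mathcal{C}$; (ii) $\llbracket f(t,x)-f(t,y),x-y\rrbracket\le b\|x-y\|^2$ for every $(t,x),(t,y)\in\mathbb{R}_{\ge0}\times\mathcal{C}$ such that $x\ge y$; (iii) $\|\phi(t,t_0,x_0)-\phi(t,t_0,y_0)\|\le e^{b(t-s)}\|\phi(s,t_0,x_0)-\phi(s,t_0,y_0)\|$ for every $t_0\le s\le t$ and every $x_0,y_0\in\mathcal{C}$. If instead $\|\cdot\|$ is not monotonic, then conditions (i) and (ii) are equivalent and, when $\mathcal{C}=[x_{\min},x_{\max}]$ for some $x_{\min}<x_{\max}$, they imply: (iv) there exists $M>0$ such that, for every $x_0,y_0\in[x_{\min},x_{\max}]$ and every $t_0\le s\le t$, $$\|\phi(t,t_0,x_0)-\phi(t,t_0,y_0)\|\le M e^{b(t-s)}\|\phi(s,t_0,x_0)-\phi(s,t_0,y_0)\|.$$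
   Context: Inequalities between vectors are entrywise, $0_n$ is the zero vector, $|x|$ is the entrywise absolute value; $[x_{\min},x_{\max}]=\{z\in\mathbb{R}^n: x_{\min}\le z\le x_{\max}\}$. $\phi(t,t_0,x_0)$ is the flow of $f$ at time $t$ starting at time $t_0\ge0$ from $x_0$; $Df(t,x)$ is the Jacobian of $f$ with respect to $x$. The vector field $f$ is assumed regular enough for these to be defined (continuous in $t$, continuously differentiable in $x$). $f$ is monotone on a convex forward invariant set $\mathcal{C}$ if for all $x_0,y_0\in\mathcal{C}$ with $x_0\le y_0$ one has $\phi(t,t_0,x_0)\le\phi(t,t_0,y_0)$ for every $t\ge t_0$. A norm is monotonic if $|x|\le|y|$ implies $\|x\|\le\|y\|$. The conic matrix measure of $A\in\mathbb{R}^{n\times n}$ with respect to $\|\cdot\|$ is $\displaystyle\mu^{+}(A)=\lim_{h\to0^{+}}\ \sup_{x\ge 0_n,\ x\neq 0_n}\frac{\|(I_n+hA)x\|/\|x\|-1}{h}$. A weak pairing (WP) on $\mathbb{R}^n$ is a map $\llbracket\cdot,\cdot\rrbracket:\mathbb{R}^n\times\mathbb{R}^n\to\mathbb{R}$ such that: (1) $\llbracket x_1+x_2,y\rrbracket\le\llbracket x_1,y\rrbracket+\llbracket x_2,y\rrbracket$ for all $x_1,x_2,y$, and it is continuous in its first argument; (2) $\llbracket\alpha x,y\rrbracket=\llbracket x,\alpha y\rrbracket=\alpha\llbracket x,y\rrbracket$ and $\llbracket -x,-y\rrbracket=\llbracket x,y\rrbracket$ for all $x,y$ and $\alpha\ge0$;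 (3) $\llbracket x,x\rrbracket>0$ for all $x\ne0_n$; (4) $|\llbracket x,y\rrbracket|\le\llbracket x,x\rrbracket^{1/2}\llbracket y,y\rrbracket^{1/2}$ for all $x,y$. It is associated with the norm $\|\cdot\|$ if $\|x\|^2=\llbracket x,x\rrbracket$ for all $x$. It satisfies Deimling's inequality if $\llbracket x,y\rrbracket\le\|y\|\lim_{h\to0^{+}}\frac{\|y+hx\|-\|y\|}{h}$ for all $x,y\in\mathbb{R}^n$.
   Formalization: The set C is additionally assumed to have nonempty interior; without this the equivalence fails, e.g. C = {0}, f(t,x) = x, b = -1, where (ii) and (iii) hold trivially but the conic matrix measure of Df is 1 > b. *)

(* Defs.v *)
From mathcomp Require Export all_boot all_order all_algebra.
From mathcomp Require Export all_classical all_reals all_analysis.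

Set Implicit Arguments.
Unset Strict Implicit.
Unset Printing Implicit Defensive.

Export Order.TTheory GRing.Theory Num.Theory.
Export numFieldNormedType.Exports.

Local Open Scope classical_set_scope.
Local Open Scope ring_scope.

Definition vle (R : realType) (n : nat) (x y : 'cV[R]_n) : Prop :=
  forall i, x i 0 <= y i 0.

Definition vlt (R : realType) (n : nat) (x y : 'cV[R]_n) : Prop :=
  forall i, x i 0 < y i 0.

Definition vabs (R : realType) (n : nat) (x : 'cV[R]_n) : 'cV[R]_n :=
  map_mx Num.norm x.

Definition vbox (R : realType) (n : nat) (a b : 'cV[R]_n) : set 'cV[R]_n :=
  [set z | vle a z /\ vle z b].

(* An arbitrary norm, unrelated to the canonical (sup) norm of ['cV[R]_n],
   which is only used for the topology. *)
Record is_norm (R : realType) (n : nat) (N : 'cV[R]_n -> R) : Prop := IsNorm {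
  norm_triangle : forall x y, N (x + y) <= N x + N y;
  norm_scale : forall (a : R) x, N (a *: x) = `|a| * N x;
  norm_definite : forall x, N x = 0 -> x = 0 }.

Definition monotonic_norm (R : realType) (n : nat) (N : 'cV[R]_n -> R) : Prop :=
  forall x y, vle (vabs x) (vabs y) -> N x <= N y.

(* For [0 < n] and a norm [N], the set is nonempty and bounded for each [h > 0]
   and its supremum converges as [h] decreases to 0, so the total operators
   [sup] and [lim] have their usual meaning. *)
Definition conic_measure (R : realType) (n : nat) (N : 'cV[R]_n -> R)
    (A : 'M[R]_n) : R :=
  lim (sup [set (N ((1%:M + h *: A) *m x) / N x - 1) / h
           | x in [set x : 'cV[R]_n | vle 0 x /\ x != 0]] @[h --> 0^'+]).

Record is_weak_pairing (R : realType) (n : nat)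
    (W : 'cV[R]_n -> 'cV[R]_n -> R) : Prop := IsWeakPairing {
  wp_subadd : forall x1 x2 y, W (x1 + x2) y <= W x1 y + W x2 y;
  wp_continuous : forall y, continuous (fun x => W x y);
  wp_homl : forall (a : R) x y, 0 <= a -> W (a *: x) y = a * W x y;
  wp_homr : forall (a : R) x y, 0 <= a -> W x (a *: y) = a * W x y;
  wp_opp : forall x y, W (- x) (- y) = W x y;
  wp_pos : forall x, x != 0 -> 0 < W x x;
  wp_cauchy_schwarz : forall x y,
    `|W x y| <= Num.sqrt (W x x) * Num.sqrt (W y y) }.

Definition wp_associated (R : realType) (n : nat) (N : 'cV[R]_n -> R)
    (W : 'cV[R]_n -> 'cV[R]_n -> R) : Prop :=
  forall x, N x ^+ 2 = W x x.

Definition deimling (R : realType) (n : nat) (N : 'cV[R]_n -> R)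
    (W : 'cV[R]_n -> 'cV[R]_n -> R) : Prop :=
  forall x y, W x y <= N y * lim ((N (y + h *: x) - N y) / h @[h --> 0^'+]).

(* Entry (i, j) is the partial derivative of the i-th component with respect to
   the j-th coordinate.  The library's [jacobian] is for row vectors and is the
   transpose of this matrix. *)
Definition Jac (R : realType) (n : nat) (g : 'cV[R]_n -> 'cV[R]_n)
    (x : 'cV[R]_n) : 'M[R]_n :=
  \matrix_(i < n, j < n) 'D_(delta_mx j 0) (fun z => g z i 0) x.

(* Vector fields live on [0, +oo[ x R^n; values at negative times are
   irrelevant. *)
Definition regular_field (R : realType) (n : nat)
    (f : R -> 'cV[R]_n -> 'cV[R]_n) : Prop :=
  (forall x, {within `[0, +oo[, continuous (fun t => f t x)}) /\
  (forall t, 0 <= t ->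
     (forall x, differentiable (f t) x) /\ continuous (Jac (f t))).

(* [u] solves the initial value problem on [t0, +oo[; the derivative is relative
   to that interval, hence one-sided at [t0]. *)
Definition is_solution (R : realType) (n : nat)
    (f : R -> 'cV[R]_n -> 'cV[R]_n) (t0 : R) (x0 : 'cV[R]_n)
    (u : R -> 'cV[R]_n) : Prop :=
  u t0 = x0 /\
  forall t, t0 <= t ->
    (s - t)^-1 *: (u s - u t) @[s --> within [set s | t0 <= s] t^'] --> f t (u t).

(* [phi t t0 x0] is the flow on [C]: the unique solution, defined for all
   [t >= t0], for each initial time [t0 >= 0] and initial state in [C]. *)
Definition is_flow (R : realType) (n : nat) (f : R -> 'cV[R]_n -> 'cV[R]_n)
    (C : set 'cV[R]_n) (phi : R -> R -> 'cV[R]_n -> 'cV[R]_n) : Prop :=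
  forall t0 x0, 0 <= t0 -> C x0 ->
    is_solution f t0 x0 (fun t => phi t t0 x0) /\
    forall u, is_solution f t0 x0 u -> forall t, t0 <= t -> u t = phi t t0 x0.

Definition forward_invariant (R : realType) (n : nat) (C : set 'cV[R]_n)
    (phi : R -> R -> 'cV[R]_n -> 'cV[R]_n) : Prop :=
  forall t t0 x0, 0 <= t0 -> t0 <= t -> C x0 -> C (phi t t0 x0).

Definition monotone_on (R : realType) (n : nat) (C : set 'cV[R]_n)
    (phi : R -> R -> 'cV[R]_n -> 'cV[R]_n) : Prop :=
  forall t0 x0 y0, 0 <= t0 -> C x0 -> C y0 -> vle x0 y0 ->
    forall t, t0 <= t -> vle (phi t t0 x0) (phi t t0 y0).

Definition conic_measure_bound (R : realType) (n : nat) (N : 'cV[R]_n -> R)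
    (f : R -> 'cV[R]_n -> 'cV[R]_n) (C : set 'cV[R]_n) (b : R) : Prop :=
  forall t x, 0 <= t -> C x -> conic_measure N (Jac (f t) x) <= b.

Definition weak_pairing_bound (R : realType) (n : nat) (N : 'cV[R]_n -> R)
    (W : 'cV[R]_n -> 'cV[R]_n -> R)
    (f : R -> 'cV[R]_n -> 'cV[R]_n) (C : set 'cV[R]_n) (b : R) : Prop :=
  forall t x y, 0 <= t -> C x -> C y -> vle y x ->
    W (f t x - f t y) (x - y) <= b * N (x - y) ^+ 2.

(* Main.v *)
Require Import Defs.
From mathcomp Require Import lra ring.

(* Kamke: two ordered states with equal i-th coordinates have ordered i-th
   velocities, so every Jacobian on C is Metzler and I + hA preserves the cone
   for small h > 0.  The cone estimate (1 - hb) N v <= N ((I - hA) v) can then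
   be applied to (I + hA) v, which turns [[A v, v]] <= b (N v)^2 on the cone
   into a bound on the conic measure; Deimling's inequality gives the converse,
   and integrating along a segment, in the form of a Dini-derivative mean value
   inequality for the sublinear map [[., v]], yields (i) <-> (ii).

   If N is monotonic, |(I + hA) v| <= (I + hA) |v| extends the bound from the
   cone to all v, hence (ii) to all pairs of points; the left Dini derivative
   of the norm of the difference of two trajectories is then at most b times
   this norm, which is (iii).  Otherwise the same argument works only for
   ordered trajectories, and on a box an arbitrary pair is compared with the
   trajectory starting from the entrywise minimum. *)

Set Implicit Arguments.
Unset Strict Implicit.
Unset Printing Implicit Defensive.

Local Open Scope classical_set_scope.
Local Open Scope ring_scope.

(** * Norms on column vectors *)

Lemma coord_le_norm (R : realType) m n (x : 'M[R]_(m, n)) i j : `|x i j| <= `|x|.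
Proof.
by rewrite [leRHS]/Num.Def.normr /= mx_normrE; exact: (le_bigmax _ _ (i, j)).
Qed.

Lemma norm_le_coord (R : realType) n (x : 'cV[R]_n) (c : R) :
  0 <= c -> (forall i, `|x i 0| <= c) -> `|x| <= c.
Proof.
move=> c0 xc; rewrite [leLHS]/Num.Def.normr /= mx_normrE.
by apply: bigmax_le => // -[i j] _ /=; rewrite (ord1 j).
Qed.

Lemma cV_decomp (R : realType) n (x : 'cV[R]_n) :
  x = \sum_i x i 0 *: delta_mx i 0.
Proof. by rewrite {1}[x]matrix_sum_delta; apply: eq_bigr => i _; rewrite big_ord1. Qed.

Section Norms.
Context (R : realType) (n : nat) (N : 'cV[R]_n -> R) (hN : is_norm N).
Implicit Types x y v : 'cV[R]_n.

Lemma norm0 : N 0 = 0.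
Proof. by rewrite -(scale0r 0) norm_scale// normr0 mul0r. Qed.

Lemma normN x : N (- x) = N x.
Proof. by rewrite -scaleN1r norm_scale// normrN1 mul1r. Qed.

Lemma norm_scale_ge0 (a : R) x : 0 <= a -> N (a *: x) = a * N x.
Proof. by move=> a0; rewrite norm_scale// ger0_norm. Qed.

Lemma norm_ge0 x : 0 <= N x.
Proof.
have := norm_triangle hN x (- x); rewrite subrr norm0 normN; lra.
Qed.

Lemma norm_gt0 x : x != 0 -> 0 < N x.
Proof.
by move=> x0; rewrite lt_def norm_ge0 andbT; apply: contraNneq x0 => /(norm_definite hN) ->.
Qed.

Lemma norm_subC x y : N (x - y) = N (y - x).
Proof. by rewrite -opprB normN. Qed.

Lemma ler_norm_sub x y : `|N x - N y| <= N (x - y).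
Proof.
have := norm_triangle hN (x - y) y; rewrite subrK.
have := norm_triangle hN (y - x) x; rewrite subrK (norm_subC y x).
by rewrite ler_norml => h1 h2; apply/andP; split; lra.
Qed.

Lemma norm_sum_le m (F : 'I_m -> 'cV[R]_n) : N (\sum_i F i) <= \sum_i N (F i).
Proof.
elim/big_ind2: _ => [|a b c d ab cd|//]; first by rewrite norm0.
by rewrite (le_trans (norm_triangle hN _ _))// lerD.
Qed.

Lemma norm_mulmx_le m (A : 'M[R]_(n, m)) :
  exists2 K, 0 < K & forall v : 'cV[R]_m, N (A *m v) <= K * `|v|.
Proof.
have S0 : 0 <= \sum_j N (A *m delta_mx j 0) by apply: sumr_ge0 => j _; exact: norm_ge0.
(* The sum alone would serve as a bound; the added 1 makes the constant strictly positive. *)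
exists (1 + \sum_j N (A *m delta_mx j 0)); first by lra.
move=> v; rewrite [X in A *m X]cV_decomp mulmx_sumr (le_trans (norm_sum_le _))//.
rewrite mulrDl mulr_suml -[leLHS]add0r lerD ?mul1r//; apply: ler_sum => j _.
rewrite -scalemxAr norm_scale// mulrC ler_wpM2l ?norm_ge0//; exact: coord_le_norm.
Qed.

Lemma norm_le_mx_norm : exists2 K, 0 < K & forall v, N v <= K * `|v|.
Proof.
by have [K K0 NK] := norm_mulmx_le 1%:M; exists K => // v; have := NK v; rewrite mul1mx.
Qed.

Lemma is_norm_continuous : continuous N.
Proof.
have [K K0 NK] := norm_le_mx_norm.
move=> x; apply/(@cvgrPdist_le _ _ _ (nbhs x)) => e e0; near=> y.
rewrite (le_trans (ler_norm_sub _ _))// (le_trans (NK _))// -ler_pdivlMl//.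
near: y; apply: (@cvgr_dist_le _ _ _ (nbhs x) _ id x) => //.
by rewrite mulr_gt0// invr_gt0.
Unshelve. all: by end_near. Qed.

(** The other half of the equivalence of norms: [N] attains a positive minimum on the compact unit
    sphere of the sup norm. Compactness is obtained for row vectors, hence the transpositions. *)
Lemma mx_norm_le_norm : exists2 K, 0 < K & forall v, `|v| <= K * N v.
Proof.
have trE (v : 'rV[R]_n) : `|v^T| = `|v|.
  apply/eqP; rewrite eq_le; apply/andP; split.
    by apply: norm_le_coord => // i; rewrite mxE coord_le_norm.
  rewrite [leLHS]/Num.Def.normr /= mx_normrE; apply: bigmax_le => // -[i j] _ /=.
  by have := coord_le_norm v^T j i; rewrite mxE.
pose S : set 'rV[R]_n := [set v | `|v| = 1].
have [[v0 Sv0]|S0] := pselect (S !=set0).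
  have cS : compact S.
    apply: bounded_closed_compact.
      exists 1; split => // M M1 v Sv; apply: le_trans (ltW M1).
      by move: Sv; rewrite /S /mkset => ->.
    apply: (@closed_comp _ _ (fun v : 'rV[R]_n => `|v|) [set 1]).
      by move=> v _; exact: norm_continuous.
    exact: closed_eq.
  have cT : continuous (trmx : 'rV[R]_n -> 'cV[R]_n).
    move=> v; apply/(@cvgrPdist_le _ _ _ (nbhs v)) => e e0; near=> w.
    rewrite -linearB/= trE.
    by near: w; apply: (@cvgr_dist_le _ _ _ (nbhs v) _ id v).
  have cf : {within S, continuous (fun v : 'rV[R]_n => N v^T)}.
    apply: continuous_subspaceT => v.
    apply: (@continuous_comp _ _ _ (trmx : 'rV[R]_n -> 'cV[R]_n) N); [exact: cT|].
    exact: is_norm_continuous.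
  have [c] := EVT_min_rV (ex_intro _ v0 Sv0) cS cf.
  rewrite inE => Sc minc.
  have c0 : 0 < N c^T.
    apply: norm_gt0; apply/eqP => c0; move: Sc; rewrite /S/= -trE c0 normr0.
    by move/esym/eqP; rewrite oner_eq0.
  exists (N c^T)^-1; first by rewrite invr_gt0.
  move=> v; have [->|v_neq0] := eqVneq v 0; first by rewrite normr0 norm0 mulr0.
  have nv : 0 < `|v| by rewrite normr_gt0.
  rewrite ler_pdivlMl// mulrC.
  have := minc (`|v|^-1 *: v^T); rewrite inE /S/=.
  rewrite linearZ/= trmxK norm_scale_ge0 ?invr_ge0// ler_pdivlMl//; apply.
  by rewrite normrZ -trE trmxK normfV normr_id mulVf// gt_eqF.
exists 1 => // v; suff -> : v = 0 by rewrite normr0 norm0 mulr0.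
apply/eqP/negPn/negP => v0; apply: S0; exists (`|v|^-1 *: v^T); rewrite /S/=.
by rewrite normrZ -trE trmxK normfV normr_id mulVf// normr_eq0.
Unshelve. all: by end_near. Qed.

Lemma norm_mulmx_bounded (A : 'M[R]_n) :
  exists2 K, 0 < K & forall v, N (A *m v) <= K * N v.
Proof.
have [K1 K10 h1] := norm_mulmx_le A; have [K2 K20 h2] := mx_norm_le_norm.
exists (K1 * K2); first exact: mulr_gt0.
by move=> v; rewrite (le_trans (h1 v))// -mulrA ler_pM2l.
Qed.

End Norms.

(** * Dini derivatives and directional derivatives of norms *)

(** Tilting [G] by [- e * t] forces its maximum to sit at [a]: at a maximizer [c > a], the Dini
    bound with [e / 2] produces a point [s < c] where the tilted function is larger. *)
Lemma left_dini_nonincreasing (R : realType) (G : R -> R) (a b : R) :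
  a <= b -> {within `[a, b], continuous G} ->
  (forall t, a < t <= b -> forall e, 0 < e ->
     \forall s \near t^'-, G t - G s <= e * (t - s)) ->
  G b <= G a.
Proof.
move=> ab cG dini; apply/ler_addgt0Pr => e0 e0_gt0.
pose e := e0 / (1 + (b - a)).
have ba0 : 0 <= b - a by rewrite subr_ge0.
have e_gt0 : 0 < e by rewrite divr_gt0//; lra.
pose K (t : R) := G t - e * t.
have cK : {within `[a, b], continuous K}.
  move=> t; apply: cvgB; first exact: cG.
  by apply: cvgMr; apply: continuous_subspaceT => u; exact: cvg_id.
have [c cab maxc] := EVT_max ab cK.
have ca : c = a.
  apply/eqP/negPn/negP => c_neq_a.
  have /andP[ac cb] : a < c <= b.
    by move: cab; rewrite in_itv/= => /andP[ac ->]; rewrite lt_def c_neq_a ac.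
  have e2 : 0 < e / 2 by rewrite divr_gt0.
  have H := dini c (introT andP (conj ac cb)) (e / 2) e2.
  have [s] : exists s, [/\ G c - G s <= e / 2 * (c - s), a < s & s < c].
    near (c^'-) => s; exists s; split.
    - by near: s.
    - by near: s; exact: nbhs_left_gt.
    - by near: s; exact: nbhs_left_lt.
  move=> [Gs as_ sc].
  have := maxc s; rewrite in_itv/= (ltW as_)/= (le_trans (ltW sc) cb) => /(_ isT).
  rewrite /K; have : 0 < e * (c - s) by rewrite mulr_gt0// subr_gt0.
  lra.
have := maxc b; rewrite ca in_itv/= ab lexx /= => /(_ isT); rewrite /K => Kba.
have : e * (b - a) <= e0.
  rewrite /e mulrAC ler_pdivrMr; last by lra.
  by rewrite ler_pM2l//; lra.
lra.
Unshelve. all: by end_near. Qed.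

(** * One-sided directional derivatives of a norm and the conic measure as a limit *)

Section DirectionalDerivative.
Context (R : realType) (n : nat) (N : 'cV[R]_n -> R) (hN : is_norm N).
Implicit Types (x y v : 'cV[R]_n) (A : 'M[R]_n) (h : R).

Definition norm_quot y x h : R := (N (y + h *: x) - N y) / h.

(** Convexity of [N]: [y + h *: x] is a convex combination of [y] and [y + k *: x]. *)
Lemma norm_quot_homo y x h k : 0 < h -> h <= k -> norm_quot y x h <= norm_quot y x k.
Proof.
move=> h0 hk; have k0 : 0 < k by exact: lt_le_trans hk.
have hk1 : h / k <= 1 by rewrite ler_pdivrMr// mul1r.
have hk0 : 0 <= h / k by rewrite divr_ge0// ltW.
have E : y + h *: x = (1 - h / k) *: y + (h / k) *: (y + k *: x).
  by rewrite scalerDr scalerA divfK ?gt_eqF// addrA -scalerDl subrK scale1r.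
have : N (y + h *: x) <= (1 - h / k) * N y + h / k * N (y + k *: x).
  by rewrite E (le_trans (norm_triangle hN _ _))// !norm_scale_ge0 ?subr_ge0.
move=> H; rewrite /norm_quot ler_pdivrMr//.
have -> : (N (y + k *: x) - N y) / k * h = h / k * (N (y + k *: x) - N y) by ring.
lra.
Qed.

Lemma norm_quot_ge y x h : 0 < h -> - N x <= norm_quot y x h.
Proof.
move=> h0; rewrite /norm_quot ler_pdivlMr//.
have := norm_triangle hN (y + h *: x) (- (h *: x)).
rewrite addrK normN// norm_scale_ge0 ?(ltW h0)//. lra.
Qed.

(** The quotient is monotone in [h] and bounded below by [- N x], so the [lim] in Deimling's
    inequality is a genuine limit. *)
Lemma cvg_norm_quot y x :
  norm_quot y x h @[h --> 0^'+] --> lim (norm_quot y x h @[h --> 0^'+]).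
Proof.
suff /cvg_ex[l cvl] : cvg (norm_quot y x h @[h --> 0^'+]) by rewrite (cvg_lim _ cvl).
apply: nondecreasing_at_right_is_cvgr.
  near=> a; move=> h k; rewrite !in_itv/= => /andP[h0 _] /andP[k0 _] hk.
  exact: norm_quot_homo.
near=> a; exists (- N x) => z [h/=]; rewrite in_itv/= => /andP[h0 _] <-.
exact: norm_quot_ge.
Unshelve. all: by end_near. Qed.

Definition conic_quot A h : set R :=
  [set (N ((1%:M + h *: A) *m x) / N x - 1) / h
           | x in [set x : 'cV[R]_n | vle 0 x /\ x != 0]].

Lemma conic_quotE A h v : v != 0 -> h != 0 ->
  (N ((1%:M + h *: A) *m v) / N v - 1) / h = norm_quot v (A *m v) h / N v.
Proof.
move=> v0 h0; rewrite /norm_quot mulmxDl mul1mx -scalemxAl.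
by field; rewrite h0 gt_eqF// norm_gt0.
Qed.

Lemma conic_quot_ubound A h : 0 < h -> has_ubound (conic_quot A h).
Proof.
move=> h0; have [K K0 NK] := norm_mulmx_bounded hN A.
exists K => _ [v [v0 vn0] <-]; rewrite conic_quotE ?gt_eqF//.
rewrite ler_pdivrMr ?norm_gt0// (le_trans _ (NK v))// /norm_quot ler_pdivrMr//.
have := norm_triangle hN v (h *: (A *m v)); rewrite norm_scale_ge0 ?(ltW h0)//; lra.
Qed.

Lemma conic_quot_le_sup A h v : 0 < h -> vle 0 v -> v != 0 ->
  norm_quot v (A *m v) h <= sup (conic_quot A h) * N v.
Proof.
move=> h0 v0 vn0; rewrite -ler_pdivrMr ?norm_gt0// -conic_quotE ?gt_eqF//.
by apply: ub_le_sup; [exact: conic_quot_ubound|exists v].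
Qed.

Lemma conic_quot_nonempty A h : (0 < n)%N -> conic_quot A h !=set0.
Proof.
move=> n0; eexists; exists (const_mx 1) => //; split.
  by move=> i; rewrite !mxE ler01.
apply/eqP => /matrixP/(_ (Ordinal n0) 0); rewrite !mxE => /eqP.
by rewrite oner_eq0.
Qed.

(** The supremum inherits monotonicity in [h] from the individual quotients, and any single vector
    of the cone bounds it from below. *)
Lemma cvg_sup_conic_quot A : (0 < n)%N ->
  sup (conic_quot A h) @[h --> 0^'+] --> conic_measure N A.
Proof.
move=> n0.
suff /cvg_ex[l cvl] : cvg (sup (conic_quot A h) @[h --> 0^'+]).
  by rewrite /conic_measure (cvg_lim _ cvl).
apply: nondecreasing_at_right_is_cvgr.
  near=> a; move=> h k; rewrite !in_itv/= => /andP[h0 _] /andP[k0 _] hk.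
  apply: ge_sup; first exact: conic_quot_nonempty.
  move=> _ [v [v0 vn0] <-]; rewrite conic_quotE ?gt_eqF// ler_pdivrMr ?norm_gt0//.
  by rewrite (le_trans (norm_quot_homo _ _ h0 hk))// conic_quot_le_sup.
have [_ [v [v0 vn0] _]] := conic_quot_nonempty 0 0 n0.
near=> a; exists (- N (A *m v) / N v) => z [h/=]; rewrite in_itv/= => /andP[h0 _] <-.
rewrite ler_pdivrMr ?norm_gt0// (le_trans (norm_quot_ge v _ h0))//.
exact: conic_quot_le_sup.
Unshelve. all: by end_near. Qed.

Lemma lim_norm_quot_le_conic_measure A v : vle 0 v -> v != 0 ->
  lim (norm_quot v (A *m v) h @[h --> 0^'+]) <= conic_measure N A * N v.
Proof.
move=> v0 vn0; have n0 : (0 < n)%N.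
  by move: v v0 vn0; case: n => // v _; rewrite (flatmx0 v) eqxx.
apply: (@ler_cvg_to _ (0^'+) _ _ (norm_quot v (A *m v))
  (fun h => sup (conic_quot A h) * N v)); [exact: cvg_norm_quot| |].
  by apply: cvgMl; exact: cvg_sup_conic_quot.
near=> h; apply: conic_quot_le_sup => //.
Unshelve. all: by end_near. Qed.

End DirectionalDerivative.

(** * Weak pairings and Metzler matrices *)

Definition metzler (R : realType) (n : nat) (A : 'M[R]_n) : Prop :=
  forall i j, i != j -> 0 <= A i j.

(** Off-diagonal entries are nonnegative for every [h > 0]; a diagonal entry [1 + h * A j j] stays
    nonnegative once [h * (1 + |A|) <= 1]. *)
Lemma metzler_near_nonneg (R : realType) (n : nat) (A : 'M[R]_n) : metzler A ->
  \forall h \near 0^'+, forall i j, 0 <= (1%:M + h *: A) i j.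
Proof.
move=> mA; have A1 : 0 < (1 + `|A|)^-1 by rewrite invr_gt0 ltr_pwDl.
near=> h => i j; have h0 : 0 < h by [].
have hA : h * (1 + `|A|) <= 1.
  rewrite -ler_pdivlMr ?ltr_pwDl// mul1r; near: h; exact: nbhs_right_le.
rewrite !mxE; have [->|ij] := eqVneq i j; last by rewrite add0r mulr_ge0 ?mA// ltW.
have : h * `|A j j| <= h * `|A| by rewrite ler_pM2l// coord_le_norm.
have : - (h * `|A j j|) <= h * A j j.
  by rewrite -mulrN ler_pM2l// lerNl ler_normr lexx orbT.
rewrite mulr1n; lra.
Unshelve. all: by end_near. Qed.

Lemma mulmx_vle0 (R : realType) (n : nat) (A : 'M[R]_n) (v : 'cV[R]_n) :
  (forall i j, 0 <= A i j) -> vle 0 v -> vle 0 (A *m v).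
Proof.
move=> A0 v0 i; rewrite !mxE; apply: sumr_ge0 => j _.
by rewrite mulr_ge0//; have := v0 j; rewrite mxE.
Qed.

Lemma vabs_ge0 (R : realType) (n : nat) (v : 'cV[R]_n) : vle 0 (vabs v).
Proof. by move=> i; rewrite !mxE. Qed.

Lemma vabs_id (R : realType) (n : nat) (v : 'cV[R]_n) : vabs (vabs v) = vabs v.
Proof. by apply/matrixP => i j; rewrite !mxE normr_id. Qed.

Lemma vabs_eq0 (R : realType) (n : nat) (v : 'cV[R]_n) : vabs v = 0 -> v = 0.
Proof.
move=> /matrixP v0; apply/matrixP => i j; have := v0 i j; rewrite !mxE.
by move/normr0P/eqP.
Qed.

Lemma vle_vabs_mulmx (R : realType) (n : nat) (A : 'M[R]_n) (v : 'cV[R]_n) :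
  (forall i j, 0 <= A i j) -> vle (vabs (A *m v)) (vabs (A *m vabs v)).
Proof.
move=> A0 i; rewrite !mxE; apply: (le_trans (ler_norm_sum _ _ _)).
rewrite (le_trans _ (ler_norm _))//; apply: ler_sum => j _.
by rewrite !mxE normrM (ger0_norm (A0 _ _)).
Qed.

Lemma monotonic_norm_vabs (R : realType) (n : nat) (N : 'cV[R]_n -> R) v :
  monotonic_norm N -> N (vabs v) = N v.
Proof.
by move=> mN; apply/eqP; rewrite eq_le; apply/andP; split; apply: mN => i;
  rewrite vabs_id.
Qed.

Section WeakPairing.
Context (R : realType) (n : nat) (N : 'cV[R]_n -> R) (W : 'cV[R]_n -> 'cV[R]_n -> R).
Hypotheses (hN : is_norm N) (hW : is_weak_pairing W) (NW : wp_associated N W).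
Implicit Types (x y v : 'cV[R]_n) (A : 'M[R]_n).

Lemma wp0l y : W 0 y = 0.
Proof. by rewrite -(scale0r 0) wp_homl// mul0r. Qed.

Lemma wp0r x : W x 0 = 0.
Proof. by rewrite -(scale0r 0) wp_homr// mul0r. Qed.

Lemma wp_le x y : W x y <= N x * N y.
Proof.
have := wp_cauchy_schwarz hW x y.
rewrite -!NW !sqrtr_sqr !(ger0_norm (norm_ge0 hN _)) => H.
apply: le_trans H; exact: ler_norm.
Qed.

Lemma wp_cvg T (F : set_system T) {FF : Filter F} (q : T -> 'cV[R]_n) w y :
  q @ F --> w -> W (q t) y @[t --> F] --> W w y.
Proof.
move=> qw.
exact: (@cvg_comp _ _ _ q (W^~ y) F (nbhs w) _ qw (@wp_continuous _ _ _ hW y w)).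
Qed.

(* For [A] Metzler, [I + hA] preserves the cone when [h] is small, so the bound
   [(1 - hb) N u <= N ((I - hA) u)] applies to [u = (I + hA) v], and
   [(I - hA)(I + hA) = I - h^2 A^2]. *)
Lemma conic_measure_le A b : (0 < n)%N -> metzler A ->
  (forall v, vle 0 v -> W (A *m v) v <= b * N v ^+ 2) ->
  conic_measure N A <= b.
Proof.
move=> n0 mA Wb; have [K K0 NK] := norm_mulmx_bounded hN (A *m A).
have lb h u : 0 < h -> vle 0 u -> (1 - h * b) * N u <= N (u - h *: (A *m u)).
  move=> h0 u0; have [->|un0] := eqVneq u 0.
    by rewrite norm0// mulr0 norm_ge0.
  (* After multiplication by [N u], the pairing of [u - h *: (A *m u)] with [u] separates the two
     sides: subadditivity bounds it from below, Cauchy-Schwarz from above. *)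
  rewrite -(ler_pM2r (norm_gt0 hN un0)) (le_trans _ (wp_le _ _))//.
  have := wp_subadd hW (u - h *: (A *m u)) (h *: (A *m u)) u.
  rewrite subrK wp_homl ?(ltW h0)// -NW.
  have := Wb u u0; rewrite -(ler_pM2l h0); lra.
(* This quotient is [((1 + h^2 K) / (1 - h b) - 1) / h], the bound that the estimate for
   [(I + hA) v] gives on the conic quotient. *)
have cvb : (K * h + b) / (1 - h * b) @[h --> 0^'+] --> b.
  have h0 : (h : R) @[h --> 0^'+] --> (0 : R) by apply: cvg_at_right_filter; exact: cvg_id.
  rewrite -[X in _ --> X](_ : (K * 0 + b) / (1 - 0 * b) = b); last first.
    by rewrite mulr0 mul0r subr0 add0r divr1.
  apply: cvgM; first by apply: cvgD; [apply: cvgMr|exact: cvg_cst].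
  apply: cvgV; first by rewrite mul0r subr0 oner_neq0.
  by apply: cvgB; [exact: cvg_cst|apply: cvgMl].
apply: ler_cvg_to (cvg_sup_conic_quot hN (A := A) n0) cvb _.
near=> h; have h0 : 0 < h by [].
have hb : 0 < 1 - h * b.
  have : h * (1 + `|b|) < 1.
    rewrite -ltr_pdivlMr ?ltr_pwDl// mul1r; near: h; apply: nbhs_right_lt.
  have : h * b <= h * `|b| by rewrite ler_pM2l// ler_norm.
  lra.
have pos : forall i j, 0 <= (1%:M + h *: A) i j.
  by near: h; exact: metzler_near_nonneg.
apply: ge_sup; first exact: conic_quot_nonempty.
move=> _ [v [v0 vn0] <-]; have Nv := norm_gt0 hN vn0.
have := lb h _ h0 (mulmx_vle0 pos v0).
have -> : (1%:M + h *: A) *m v - h *: (A *m ((1%:M + h *: A) *m v)) =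
          v - (h ^+ 2) *: (A *m A *m v).
  rewrite !mulmxDl !mulmxDr !mul1mx -!scalemxAl -!scalemxAr !scalerDr mulmxA.
  by rewrite scalerA expr2 opprD addrA addrK.
set a := N (_ *m v) => la.
have : a * (1 - h * b) <= (1 + h ^+ 2 * K) * N v.
  rewrite mulrC (le_trans la)// (le_trans (norm_triangle hN _ _))// normN//.
  rewrite norm_scale_ge0 ?sqr_ge0// mulrDl mul1r lerD2l -mulrA.
  by rewrite ler_wpM2l ?sqr_ge0.
rewrite ler_pdivrMr// lerBlDr ler_pdivrMr// => H.
rewrite -(ler_pM2r hb) (le_trans H)//.
have -> : ((K * h + b) / (1 - h * b) * h + 1) * N v * (1 - h * b) =
  ((K * h + b) * h + (1 - h * b)) * N v by field; rewrite gt_eqF.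
rewrite ler_pM2r//; lra.
Unshelve. all: by end_near. Qed.

Hypothesis hD : deimling N W.

Lemma wp_le_of_norm_quot x y c :
  lim (norm_quot N y x h @[h --> 0^'+]) <= c * N y -> W x y <= c * N y ^+ 2.
Proof.
move=> H; apply: le_trans (hD x y) _.
by rewrite expr2 mulrA mulrC ler_wpM2r ?norm_ge0.
Qed.

Lemma wp_le_conic A b v : conic_measure N A <= b -> vle 0 v ->
  W (A *m v) v <= b * N v ^+ 2.
Proof.
move=> Ab v0; have [->|vn0] := eqVneq v 0.
  by rewrite wp0r norm0// expr0n mulr0.
apply: wp_le_of_norm_quot; apply: le_trans (lim_norm_quot_le_conic_measure hN _ v0 vn0) _.
by rewrite ler_wpM2r ?norm_ge0.
Qed.

Lemma wp_le_conic_monotonic A b v : monotonic_norm N -> metzler A ->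
  conic_measure N A <= b -> W (A *m v) v <= b * N v ^+ 2.
Proof.
move=> mN mA Ab; have [->|vn0] := eqVneq v 0.
  by rewrite wp0r norm0// expr0n mulr0.
have an0 : vabs v != 0 by apply: contraNneq vn0 => /vabs_eq0 ->.
have /le_trans bd := lim_norm_quot_le_conic_measure hN A (@vabs_ge0 _ _ v) an0.
apply: wp_le_of_norm_quot; apply: (@le_trans _ _ (b * N (vabs v))); last first.
  by rewrite monotonic_norm_vabs.
apply: le_trans (bd (b * N (vabs v)) _); last by rewrite ler_wpM2r ?norm_ge0.
(* The derivative at [v] is compared with the one at [vabs v], which lies in the cone and has the
   same norm. *)
apply: (@ler_cvg_to _ (0^'+) _ _ (norm_quot N v (A *m v))
  (norm_quot N (vabs v) (A *m vabs v))); [exact: cvg_norm_quot|exact: cvg_norm_quot|].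
near=> h; have h0 : 0 < h by [].
have pos : forall i j, 0 <= (1%:M + h *: A) i j.
  by near: h; exact: metzler_near_nonneg.
rewrite /norm_quot monotonic_norm_vabs// ler_pM2r ?invr_gt0// lerD2r.
by have := mN _ _ (vle_vabs_mulmx v pos); rewrite !mulmxDl !mul1mx -!scalemxAl.
Unshelve. all: by end_near. Qed.

End WeakPairing.

(** * Jacobians on convex sets *)

Lemma convex_set_comb (R : realType) (n : nat) (C : set 'cV[R]_n) x y (a : R) :
  convex_set C -> C x -> C y -> 0 <= a -> a <= 1 -> C (a *: x + (1 - a) *: y).
Proof.
move=> cC Cx Cy a0 a1.
by have := cC x y (Itv01 a0 a1) (mem_set Cx) (mem_set Cy); rewrite inE.
Qed.

Lemma sub_cvg_dnbhs (R : realType) (t : R) : (s - t) @[s --> t^'] --> 0^'.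
Proof.
move=> P; rewrite /dnbhs /= => P0; rewrite /within/=.
have : \forall s \near t, s - t != 0 -> P (s - t).
  have st : (s - t) @[s --> t] --> (0 : R).
    by rewrite -[X in _ --> X](subrr t); apply: cvgB; [exact: cvg_id|exact: cvg_cst].
  exact: st P0.
apply: filterS => s H st; apply: H; by rewrite subr_eq0.
Qed.

Lemma sub_cvg_at_right (R : realType) (t : R) : (s - t) @[s --> t^'+] --> 0^'+.
Proof.
move=> P; rewrite /at_right /= => P0; rewrite /within/=.
have : \forall s \near t, 0 < s - t -> P (s - t).
  have st : (s - t) @[s --> t] --> (0 : R).
    by rewrite -[X in _ --> X](subrr t); apply: cvgB; [exact: cvg_id|exact: cvg_cst].
  exact: st P0.
apply: filterS => s H st; apply: H; by rewrite subr_gt0.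
Qed.

Lemma cvg_at_right_id (R : realType) (t : R) : s @[s --> t^'+] --> t.
Proof. by apply: (@cvg_at_right_filter _ _ id). Qed.

Section Jacobian.
Context (R : realType) (n : nat) (g : 'cV[R]_n -> 'cV[R]_n).
Implicit Types (x y v : 'cV[R]_n).

Lemma diff_Jac x v : differentiable g x -> 'd g x v = Jac g x *m v.
Proof.
move=> dg; rewrite {1}[v]cV_decomp raddf_sum/=; apply/matrixP => i j.
rewrite (ord1 j) summxE mxE; apply: eq_bigr => k _.
rewrite linearZ/= !mxE mulrC -deriveE// derive_mx; last exact: diff_derivable.
by rewrite mxE.
Qed.

Lemma Jac_quot y v (t : R) : differentiable g (y + t *: v) ->
  (s - t)^-1 *: (g (y + s *: v) - g (y + t *: v)) @[s --> t^'] -->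
  Jac g (y + t *: v) *m v.
Proof.
move=> dg; have /cvg_ex[/= l Hl] := @diff_derivable _ _ _ g (y + t *: v) v dg.
have : l = Jac g (y + t *: v) *m v.
  by rewrite -diff_Jac// -deriveE// /derive (cvg_lim _ Hl).
move=> <-; have := @cvg_comp _ _ _ (fun s => s - t) _ (t^') (0^') _ (@sub_cvg_dnbhs R t) Hl.
rewrite (_ : _ \o _ = fun s => (s - t)^-1 *: (g (y + s *: v) - g (y + t *: v)))//.
apply/funext => s /=; congr (_ *: (g _ - _)).
by rewrite addrCA -scalerDl subrK.
Qed.

End Jacobian.

(** * Core points of a convex set *)

Section Core.
Context (R : realType) (n : nat) (C : set 'cV[R]_n).
Implicit Types (x p v : 'cV[R]_n).

(** The algebraic interior: a short ray in every direction stays in [C], which is what one-sided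
    difference quotients at [x] require. *)
Definition core_point x : Prop := forall v, \forall h \near 0^'+, C (x + h *: v).

(** The homothety of ratio [e] centred at [x] maps a neighbourhood of [p] contained in [C] to one of
    the new point, and convexity keeps its image in [C]. *)
Lemma core_point_segment x p (e : R) : convex_set C -> C x -> C° p ->
  0 < e -> e <= 1 -> core_point (x + e *: (p - x)).
Proof.
move=> cC Cx Cp e0 e1 v.
have cp : p + (h / e) *: v @[h --> 0^'+] --> p.
  rewrite -[X in _ --> X](_ : p + (0 / e) *: v = p); last by rewrite mul0r scale0r addr0.
  apply: cvgD; first exact: cvg_cst.
  apply: cvgZl; apply: cvgMl; exact: (@cvg_at_right_id R 0).
have : \forall h \near 0^'+, C (p + (h / e) *: v) := cp _ Cp.
apply: filterS => h Ch.
have -> : x + e *: (p - x) + h *: v = e *: (p + (h / e) *: v) + (1 - e) *: x.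
  by apply/matrixP => i j; rewrite !mxE; field; rewrite gt_eqF.
by apply: convex_set_comb => //; exact: ltW.
Qed.

Lemma core_point_sub x : core_point x -> C x.
Proof.
move=> /(_ 0) H; near ((0 : R)^'+) => h.
have : C (x + h *: 0) by near: h.
by rewrite scaler0 addr0.
Unshelve. all: by end_near. Qed.

(* The interior is dense in a convex set with nonempty interior. *)
Lemma core_point_dense (T : topologicalType) (J : 'cV[R]_n -> T) (q : T -> R) (c : R) :
  convex_set C -> C° !=set0 -> continuous J -> continuous q ->
  (forall x, core_point x -> q (J x) <= c) ->
  forall x, C x -> q (J x) <= c.
Proof.
move=> cC [p Cp] cJ cq H x Cx.
have cx : x + e *: (p - x) @[e --> 0^'+] --> x.
  rewrite -[X in _ --> X](_ : x + 0 *: (p - x) = x); last by rewrite scale0r addr0.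
  apply: cvgD; first exact: cvg_cst.
  by apply: cvgZl; exact: (@cvg_at_right_id R 0).
have cqJ : q (J (x + e *: (p - x))) @[e --> 0^'+] --> q (J x).
  have cqJ0 : {for x, continuous (q \o J)}.
    by apply: continuous_comp; [exact: cJ|exact: cq].
  exact: (@cvg_comp _ _ _ (fun e : R => x + e *: (p - x)) (q \o J) _ _ _ cx cqJ0).
apply: cvgr_to_le cqJ _; near=> e; apply: H; apply: core_point_segment => //.
near: e; exact: nbhs_right_le.
Unshelve. all: by end_near. Qed.

End Core.

(** Subadditivity of [W] in its first argument bounds the increments of [G] by pairings of
    increments of [g], so the left Dini derivative of [G] is at most 0. *)
Lemma wp_mean_value (R : realType) (n : nat) (W : 'cV[R]_n -> 'cV[R]_n -> R)
    (g : 'cV[R]_n -> 'cV[R]_n) (y v : 'cV[R]_n) (c : R) :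
  is_weak_pairing W -> (forall x, differentiable g x) ->
  (forall s, 0 <= s -> s <= 1 -> W (Jac g (y + s *: v) *m v) v <= c) ->
  W (g (y + v) - g y) v <= c.
Proof.
move=> hW dg Jc; pose G (s : R) := W (g (y + s *: v) - g y) v - c * s.
suff : G 1 <= G 0.
  by rewrite /G scale1r scale0r addr0 subrr (wp0l hW) mulr1 mulr0 subr0 subr_le0.
apply: left_dini_nonincreasing => //.
  apply: continuous_subspaceT => s; apply: cvgB; last by apply: cvgMr; exact: cvg_id.
  apply: (wp_cvg hW); apply: cvgB; last exact: cvg_cst.
  apply: (@cvg_comp _ _ _ (fun s => y + s *: v) g).
    by apply: cvgD; [exact: cvg_cst|apply: cvgZl; exact: cvg_id].
  exact: (differentiable_continuous (dg (y + s *: v))).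
move=> t /andP[t0 t1] e e0.
have /cvg_dnbhs_at_left cvq := @Jac_quot _ _ g y v t (dg _).
have cvW : W ((s - t)^-1 *: (g (y + s *: v) - g (y + t *: v))) v @[s --> t^'-]
    --> W (Jac g (y + t *: v) *m v) v by exact: wp_cvg cvq.
move: cvW => /cvgrPdist_le/(_ e e0) H.
near=> s; have st : s < t by [].
have : W ((s - t)^-1 *: (g (y + s *: v) - g (y + t *: v))) v <= c + e.
  have := Jc t (ltW t0) t1.
  have : `|W (Jac g (y + t *: v) *m v) v -
    W ((s - t)^-1 *: (g (y + s *: v) - g (y + t *: v))) v| <= e by near: s.
  rewrite ler_norml => /andP[]; lra.
(* Here [s - t < 0]; both signs are flipped so that positive homogeneity applies. *)
rewrite -[s - t]opprB -[g _ - _]opprB invrN scaleNr scalerN opprK => Wq; rewrite /G.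
have := wp_subadd hW (g (y + t *: v) - g (y + s *: v)) (g (y + s *: v) - g y) v.
rewrite addrA subrK.
have ts : 0 < t - s by rewrite subr_gt0.
have : W (g (y + t *: v) - g (y + s *: v)) v <= (t - s) * (c + e).
  rewrite -ler_pdivrMl//; move: Wq; rewrite wp_homl// invr_ge0; exact: ltW.
lra.
Unshelve. all: by end_near. Qed.

(** * Solutions *)

Section Solutions.
Context (R : realType) (n : nat) (f : R -> 'cV[R]_n -> 'cV[R]_n).
Implicit Types (x y : 'cV[R]_n) (u v : R -> 'cV[R]_n).

Lemma solution_right t0 x u t : is_solution f t0 x u -> t0 <= t ->
  (s - t)^-1 *: (u s - u t) @[s --> t^'+] --> f t (u t).
Proof.
move=> [_ /(_ t) sol] t0t P nP.
have H : \forall s \near t, s != t -> t0 <= s -> P ((s - t)^-1 *: (u s - u t)).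
  exact: sol t0t P nP.
apply: filterS H => s H ts; apply: H; first by rewrite gt_eqF.
exact: le_trans t0t (ltW ts).
Qed.

Lemma solution_left t0 x u t : is_solution f t0 x u -> t0 < t ->
  (s - t)^-1 *: (u s - u t) @[s --> t^'-] --> f t (u t).
Proof.
move=> [_ /(_ t) sol] t0t P nP.
have H : \forall s \near t, s != t -> t0 <= s -> P ((s - t)^-1 *: (u s - u t)).
  exact: sol (ltW t0t) P nP.
have H2 : \forall s \near t, t0 < s by exact: lt_nbhsr.
apply: filterS2 H H2 => s H t0s ts; apply: H; last exact: ltW.
by rewrite lt_eqF.
Qed.

(** Near each time the difference quotient is within 1 of its limit, hence bounded, which gives a
    local Lipschitz estimate. *)
Lemma solution_continuous t0 x u (a b : R) : is_solution f t0 x u -> t0 <= a ->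
  {within `[a, b], continuous u}.
Proof.
move=> [_ sol] t0a; apply/subspace_continuousP => t /=.
rewrite in_itv/= => /andP[at_ tb]; apply/cvgrPdist_le => e e0.
set w := f t (u t).
have H : \forall s \near t, s != t -> t0 <= s -> `|w - (s - t)^-1 *: (u s - u t)| <= 1.
  by have /cvgrPdist_le/(_ 1 ltr01) := sol t (le_trans t0a at_).
have w1 : 0 < `|w| + 1 by rewrite ltr_wpDl.
have cs : \forall s \near t, `|t - s| <= e / (`|w| + 1).
  apply: (@cvgr_dist_le _ _ _ (nbhs t) _ id t) => //; exact: divr_gt0.
suff : \forall s \near t, s \in `[a, b] -> `|u t - u s| <= e by [].
apply: filterS2 H cs => s H ts /=; rewrite in_itv/= => /andP[as_ sb].
have [->|st] := eqVneq s t; first by rewrite subrr normr0 ltW.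
have st0 : s - t != 0 by rewrite subr_eq0.
have qs := H st (le_trans t0a as_).
set q := _ *: _ in qs.
have -> : u t - u s = (t - s) *: q.
  by rewrite /q scalerA -[t - s]opprB mulNr divff// scaleN1r opprB.
rewrite normrZ (le_trans (ler_wpM2r (normr_ge0 _) ts))//.
rewrite mulrAC ler_pdivrMr// ler_pM2l//.
by rewrite -lerBlDl (le_trans (lerB_dist _ _))// distrC.
Qed.

Lemma solution_restrict t0 x u s : is_solution f t0 x u -> t0 <= s ->
  is_solution f s (u s) u.
Proof.
move=> [_ sol] t0s; split => // t st P nP.
have H : \forall r \near t, r != t -> t0 <= r -> P ((r - t)^-1 *: (u r - u t)).
  exact: sol t (le_trans t0s st) P nP.
suff : \forall r \near t, r != t -> s <= r -> P ((r - t)^-1 *: (u r - u t)) by [].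
by apply: filterS H => r H rt sr; apply: H rt (le_trans t0s sr).
Qed.

(** The claim is that [expR (- (b * r)) * N (d r)] is nonincreasing. Pairing
    [d r = d r' + (r - r') *: q r'] with [d r] bounds the backward increment of [N (d r)], hence the
    left Dini derivative. *)
Lemma wp_solution_contraction (N : 'cV[R]_n -> R) (W : 'cV[R]_n -> 'cV[R]_n -> R)
    (b : R) t0 x y u v :
  is_norm N -> is_weak_pairing W -> wp_associated N W ->
  is_solution f t0 x u -> is_solution f t0 y v ->
  (forall t, t0 <= t ->
     W (f t (u t) - f t (v t)) (u t - v t) <= b * N (u t - v t) ^+ 2) ->
  forall s t, t0 <= s -> s <= t ->
    N (u t - v t) <= expR (b * (t - s)) * N (u s - v s).
Proof.
move=> hN hW NW su sv Wb s t t0s st.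
pose d r := u r - v r; pose G r := expR (- (b * r)) * N (d r).
suff : G t <= G s.
  rewrite /G -(ler_pM2l (expR_gt0 (b * t))) !mulrA -!expRD subrr expR0 mul1r.
  by rewrite mulrBr.
apply: left_dini_nonincreasing => //.
  move=> r; apply: cvgM.
    apply: (@continuous_comp _ _ _ (fun r : subspace `[s, t] => - (b * r)) expR).
      apply: cvgN; apply: cvgMr.
      by apply: continuous_subspaceT => r'; exact: cvg_id.
    exact: continuous_expR.
  apply: (@continuous_comp _ _ _ (d : subspace `[s, t] -> _) N).
    by apply: cvgB; [exact: (solution_continuous su)|exact: (solution_continuous sv)].
  exact: is_norm_continuous.
move=> r /andP[sr rt] e e0; have t0r : t0 < r by exact: le_lt_trans sr.
pose E := expR (- (b * r)); have E0 : 0 < E by exact: expR_gt0.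
(* With this choice [E * (2 * e') = e / 2]; the other half of [e] absorbs the second-order term in
   [h]. *)
pose e' := e / (4 * E).
have e'0 : 0 < e' by rewrite divr_gt0// mulr_gt0.
have Nr0 : 0 <= N (d r) by exact: norm_ge0.
pose q r' := (r' - r)^-1 *: (d r' - d r).
have cq : q r' @[r' --> r^'-] --> f r (u r) - f r (v r).
  rewrite (_ : q = fun r' => (r' - r)^-1 *: (u r' - u r) - (r' - r)^-1 *: (v r' - v r)).
    by apply: cvgB; [exact: solution_left su t0r|exact: solution_left sv t0r].
  apply/funext => r'; rewrite -scalerBr; congr (_ *: _).
  by apply/matrixP => i j; rewrite !mxE; ring.
have cW : W (q r') (d r) @[r' --> r^'-] --> W (f r (u r) - f r (v r)) (d r).
  exact: wp_cvg cq.
have lower : \forall r' \near r^'-,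
    N (d r) <= N (d r') + (r - r') * (b * N (d r) + e').
  (* The pairing estimate is divided by [N (d r)]; when [d r = 0] the bound is immediate. *)
  have [d0|d0] := eqVneq (d r) 0.
    near=> r'; rewrite d0 norm0// mulr0 add0r addr_ge0 ?norm_ge0//.
    by rewrite mulr_ge0 ?(ltW e'0)// subr_ge0; near: r'; exact: nbhs_left_le.
  have Nr : 0 < N (d r) by exact: norm_gt0.
  have eN : 0 < e' * N (d r) by exact: mulr_gt0.
  move: (cW) => /cvgrPdist_le/(_ _ eN) H.
  near=> r'; have rr : r' < r by [].
  have rr0 : 0 < r - r' by rewrite subr_gt0.
  have : `|W (f r (u r) - f r (v r)) (d r) - W (q r') (d r)| <= e' * N (d r).
    by near: r'.
  rewrite ler_norml => /andP[W1 _].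
  have W2 := Wb r (ltW t0r).
  rewrite -(ler_pM2r Nr).
  have := wp_subadd hW (d r') ((r - r') *: q r') (d r).
  have -> : d r' + (r - r') *: q r' = d r.
    have r0 : r' - r != 0 by rewrite subr_eq0 lt_eqF.
    by rewrite /q scalerA -[r - r']opprB mulNr divff// scaleN1r opprB addrC subrK.
  rewrite wp_homl ?(ltW rr0)// -NW.
  have := wp_le hN hW NW (d r') (d r).
  have : (r - r') * W (q r') (d r) <= (r - r') * (b * N (d r) ^+ 2 + e' * N (d r)).
    rewrite ler_pM2l//; move: W1 W2; rewrite -/(d r); lra.
  lra.
have bNE : 0 <= b ^+ 2 * N (d r) * E.
  apply: mulr_ge0; last exact: ltW.
  by apply: mulr_ge0 => //; exact: sqr_ge0.
have e2 : 0 < e / 2 by exact: divr_gt0.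
(* The single condition [h * K <= 1] yields both [|h b| <= 1] and a second-order term of at most
   [e / 2]. *)
pose K := 1 + `|b| + b ^+ 2 * N (d r) * E / (e / 2).
have K1 : 1 + `|b| <= K.
  by rewrite lerDl divr_ge0// ltW.
have K0 : 0 < K by apply: lt_le_trans K1; rewrite ltr_pwDl.
near=> r'; have rr : r' < r by [].
pose h := r - r'; have h0 : 0 < h by rewrite subr_gt0.
have hK : h * K <= 1.
  rewrite -ler_pdivlMr// mul1r /h lerBlDr -lerBlDl; near: r'.
  by apply: nbhs_left_ge; rewrite ltrBlDr ltrDl invr_gt0.
have hb : h * `|b| <= 1.
  by apply: le_trans hK; rewrite ler_pM2l//; apply: le_trans K1; rewrite lerDr.
have hb2 : `|h * b| <= 1 by rewrite normrM (gtr0_norm h0).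
have /andP[hb3 hb4] : -1 <= h * b <= 1 by rewrite -ler_norml.
have hE : h * (b ^+ 2 * N (d r) * E) <= e / 2.
  rewrite -[leRHS]mul1r -ler_pdivrMr// -(mulrA h); apply: le_trans hK.
  by rewrite ler_pM2l// lerDr addr_ge0.
have low : N (d r) <= N (d r') + h * (b * N (d r) + e') by rewrite /h; near: r'.
have -> : G r' = E * expR (b * h) * N (d r').
  by rewrite /G /E -expRD; congr (expR _ * _); rewrite /h; ring.
have ex : 1 + b * h <= expR (b * h) by exact: expR_ge1Dx.
have ex2 : (1 + b * h) * N (d r') <= expR (b * h) * N (d r').
  by rewrite ler_wpM2r ?norm_ge0.
have ex3 : (1 + b * h) * ((1 - b * h) * N (d r) - h * e') <= (1 + b * h) * N (d r').
  rewrite ler_wpM2l//; lra.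
(* Expanding the product [(1 + b h)(1 - b h)] leaves the error [h^2 b^2 N (d r)], and [1 + b h <= 2]
   bounds the factor of [h * e']. *)
have : N (d r) - expR (b * h) * N (d r') <= h * (h * (b ^+ 2 * N (d r)) + 2 * e').
  have : 0 <= (1 - b * h) * (h * e').
    by apply: mulr_ge0; [lra|apply: mulr_ge0; exact: ltW].
  lra.
rewrite -(ler_pM2l E0) => H; rewrite /G -/E -/h -mulrA -mulrBr (le_trans H)//.
have -> : E * (h * (h * (b ^+ 2 * N (d r)) + 2 * e')) =
  (h * (b ^+ 2 * N (d r) * E) + e / 2) * h by rewrite /e'; field; rewrite gt_eqF.
rewrite ler_pM2r//; lra.
Unshelve. all: by end_near. Qed.

(** By Deimling's inequality it suffices to bound the right derivative of [N] at [d0] along [w]. The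
    line [d0 + h *: w] differs from the true difference of solutions by [h *: (w - q r)], a
    first-order negligible term. *)
Lemma wp_le_of_contraction (N : 'cV[R]_n -> R) (W : 'cV[R]_n -> 'cV[R]_n -> R)
    (b : R) t0 x y u v :
  is_norm N -> deimling N W -> is_solution f t0 x u -> is_solution f t0 y v ->
  (forall t, t0 <= t -> N (u t - v t) <= expR (b * (t - t0)) * N (x - y)) ->
  W (f t0 x - f t0 y) (x - y) <= b * N (x - y) ^+ 2.
Proof.
move=> hN hD su sv ctr; apply: (wp_le_of_norm_quot hN hD).
have [ux vy] : u t0 = x /\ v t0 = y by split; [case: su|case: sv].
set w := f t0 x - f t0 y; set d0 := x - y.
pose q r := (r - t0)^-1 *: ((u r - v r) - d0).
have cq : q r @[r --> t0^'+] --> w.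
  rewrite (_ : q = fun r => (r - t0)^-1 *: (u r - u t0) - (r - t0)^-1 *: (v r - v t0)).
    have := solution_right su (lexx _); have := solution_right sv (lexx _).
    by rewrite ux vy => cv cu; apply: cvgB.
  apply/funext => r; rewrite -scalerBr /q /d0 ux vy; congr (_ *: _).
  by apply/matrixP => i j; rewrite !mxE; ring.
have cl : norm_quot N d0 w (r - t0) @[r --> t0^'+] -->
    lim (norm_quot N d0 w h @[h --> 0^'+]).
  exact: (@cvg_comp _ _ _ (fun r => r - t0) (norm_quot N d0 w) (t0^'+) (0^'+) _
    (@sub_cvg_at_right R t0) (@cvg_norm_quot _ _ _ hN d0 w)).
have cNq : N (w - q r) @[r --> t0^'+] --> (0 : R).
  rewrite -(norm0 hN) -(subrr w).
  have cwq : w - q r @[r --> t0^'+] --> w - w by apply: cvgB => //; exact: cvg_cst.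
  exact: (@cvg_comp _ _ _ (fun r => w - q r) N (t0^'+) (nbhs (w - w)) _ cwq
    (@is_norm_continuous _ _ _ hN (w - w))).
(* The bound [expR (b h) <= (1 - b h)^-1] replaces the exponential, and
   [((1 - b h)^-1 - 1) / h = b / (1 - b h)]. *)
have cb : b / (1 - b * (r - t0)) * N d0 + N (w - q r) @[r --> t0^'+] --> b * N d0.
  rewrite -[X in _ --> X]addr0; apply: cvgD => //; apply: cvgMl.
  rewrite -[X in _ --> X](_ : b / (1 - b * (t0 - t0)) = b); last first.
    by rewrite subrr mulr0 subr0 divr1.
  apply: cvgMr; apply: cvgV; first by rewrite subrr mulr0 subr0 oner_neq0.
  apply: cvgB; [exact: cvg_cst|apply: cvgMr; apply: cvgB; last exact: cvg_cst].
  exact: (@cvg_at_right_id R t0).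
apply: ler_cvg_to cl cb _; near=> r; have t0r : t0 < r by [].
pose h := r - t0; have h0 : 0 < h by rewrite subr_gt0.
have hb : 0 < 1 - b * h.
  have : h * (1 + `|b|) < 1.
    rewrite -ltr_pdivlMr ?ltr_pwDl// mul1r /h ltrBlDl; near: r; apply: nbhs_right_lt.
    by rewrite ltrDl invr_gt0 ltr_pwDl.
  have : h * b <= h * `|b| by rewrite ler_pM2l// ler_norm.
  lra.
rewrite -/h /norm_quot ler_pdivrMr// lerBlDr.
have -> : d0 + h *: w = (u r - v r) + h *: (w - q r).
  have hq : h *: q r = u r - v r - d0 by rewrite /q -/h scalerA divff ?gt_eqF// scale1r.
  rewrite (scalerBr h w (q r)) hq; move: (u r - v r) (h *: w) (d0) => U V D.
  by rewrite opprB [U + _]addrC -!addrA addNr addr0 addrC.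
apply: le_trans (norm_triangle hN _ _) _; rewrite norm_scale_ge0 ?(ltW h0)//.
have : N (u r - v r) <= (1 - b * h)^-1 * N d0.
  apply: le_trans (ctr r (ltW t0r)) _; rewrite ler_wpM2r ?norm_ge0// -/h.
  rewrite -{1}[b * h]opprK expRN lef_pV2 ?posrE ?expR_gt0//.
  exact: expR_ge1Dx.
have -> : (1 - b * h)^-1 * N d0 = b / (1 - b * h) * N d0 * h + N d0.
  by field; rewrite gt_eqF.
lra.
Unshelve. all: by end_near. Qed.

End Solutions.

(** * Monotone flows *)

Lemma mulmxr_continuous (R : realType) (n : nat) (v : 'cV[R]_n) :
  continuous (fun A : 'M[R]_n => A *m v).
Proof.
move=> A; pose K := 1 + \sum_j `|v j 0|.
have S0 : 0 <= \sum_j `|v j 0| by exact: sumr_ge0.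
have K0 : 0 < K by rewrite /K; lra.
apply/(@cvgrPdist_le _ _ _ (nbhs A)) => e e0; near=> B.
rewrite -mulmxBl; apply: norm_le_coord; first exact: ltW.
move=> i; rewrite mxE (le_trans (ler_norm_sum _ _ _))//.
apply: (@le_trans _ _ (`|A - B| * K)).
  rewrite /K mulrDr mulr_sumr -[leLHS]add0r lerD ?mulr1//; apply: ler_sum => j _.
  by rewrite normrM ler_wpM2r// coord_le_norm.
rewrite -ler_pdivlMr//; near: B.
by apply: (@cvgr_dist_le _ _ _ (nbhs A) _ id A) => //; exact: divr_gt0.
Unshelve. all: by end_near. Qed.

Section Flow.
Context (R : realType) (n : nat) (f : R -> 'cV[R]_n -> 'cV[R]_n)
  (phi : R -> R -> 'cV[R]_n -> 'cV[R]_n) (C : set 'cV[R]_n).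
Hypotheses (hf : regular_field f) (cC : convex_set C) (iC : C° !=set0)
  (hphi : is_flow f C phi) (invC : forward_invariant C phi).
Implicit Types (x y v : 'cV[R]_n) (t s : R).

Lemma field_differentiable t : 0 <= t -> forall x, differentiable (f t) x.
Proof. by move=> t0; have [] := hf.2 t t0. Qed.

Lemma flow_start t x : 0 <= t -> C x -> phi t t x = x.
Proof. by move=> t0 Cx; have [[]] := hphi t0 Cx. Qed.

(** Uniqueness: the original trajectory, restricted to times after [s], also solves the restarted
    problem. *)
Lemma flow_restart t0 s t x : 0 <= t0 -> t0 <= s -> s <= t -> C x ->
  phi t s (phi s t0 x) = phi t t0 x.
Proof.
move=> t00 t0s st Cx; have [sol _] := hphi t00 Cx.
have [_ uniq] := hphi (le_trans t00 t0s) (invC t00 t0s Cx).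
by have := uniq _ (solution_restrict sol t0s) t st => ->.
Qed.

Lemma Jac_quot_right t x v : 0 <= t ->
  h^-1 *: (f t (x + h *: v) - f t x) @[h --> 0^'+] --> Jac (f t) x *m v.
Proof.
move=> t0; have := @Jac_quot _ _ (f t) x v 0 (field_differentiable t0 _).
rewrite scale0r addr0 => /cvg_dnbhs_at_right H.
rewrite (_ : (fun _ => _) = fun h => (h - 0)^-1 *: (f t (x + h *: v) - f t x))//.
by apply/funext => h; rewrite subr0.
Qed.

(** At a core point the ordered pair [x <= x + h *: v] lies in [C]; homogeneity in both arguments
    cancels [h], and [h] tends to 0. Density of core points gives the rest of [C]. *)
Lemma conic_wp_bound (N : 'cV[R]_n -> R) (W : 'cV[R]_n -> 'cV[R]_n -> R) (b : R) t x v :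
  is_norm N -> is_weak_pairing W -> weak_pairing_bound N W f C b ->
  0 <= t -> C x -> vle 0 v -> W (Jac (f t) x *m v) v <= b * N v ^+ 2.
Proof.
move=> hN hW Wb t0 Cx v0.
have cJ : continuous (Jac (f t)) by have [] := hf.2 t t0.
have cq : continuous (fun A : 'M[R]_n => W (A *m v) v).
  move=> A; apply: (@continuous_comp _ _ _ (fun A : 'M[R]_n => A *m v) (W^~ v)).
    exact: mulmxr_continuous.
  exact: (@wp_continuous _ _ _ hW).
apply: (core_point_dense cC iC cJ cq) Cx => {}x core.
have cW : W (h^-1 *: (f t (x + h *: v) - f t x)) v @[h --> 0^'+]
   --> W (Jac (f t) x *m v) v by apply: wp_cvg => //; exact: Jac_quot_right.
have corev := core v; apply: cvgr_to_le cW _; near=> h; have h0 : 0 < h by [].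
have Ch : C (x + h *: v) by near: h.
have xh : vle x (x + h *: v).
  by move=> i; rewrite !mxE lerDl mulr_ge0 ?(ltW h0)//; have := v0 i; rewrite mxE.
have := Wb t _ _ t0 Ch (core_point_sub core) xh.
rewrite [x + _]addrC addrK wp_homr ?(ltW h0)// norm_scale_ge0 ?(ltW h0)//.
rewrite wp_homl ?invr_ge0 ?(ltW h0)// ler_pdivrMl//.
by rewrite exprMn mulrCA expr2 -mulrA ler_pM2l.
Unshelve. all: by end_near. Qed.

Hypothesis mono : monotone_on C phi.

(* Kamke's condition: the [i]-th coordinates of the two trajectories touch at
   time [t], hence their velocities are ordered. *)
Lemma monotone_field_le t x y i : 0 <= t -> C x -> C y -> vle x y ->
  x i 0 = y i 0 -> f t x i 0 <= f t y i 0.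
Proof.
move=> t0 Cx Cy xy xyi; have [sx _] := hphi t0 Cx; have [sy _] := hphi t0 Cy.
have coord z : C z -> ((s - t)^-1 *: (phi s t z - z)) i 0 @[s --> t^'+] --> f t z i 0.
  move=> Cz; have [sz _] := hphi t0 Cz; have := solution_right sz (lexx _).
  rewrite flow_start// => cz.
  exact: (@cvg_comp _ _ _ (fun s => (s - t)^-1 *: (phi s t z - z))
    (fun M : 'cV[R]_n => M i 0) _ _ _ cz (@coord_continuous R n 1 i 0 (f t z))).
apply: ler_cvg_to (coord x Cx) (coord y Cy) _; near=> s; have ts : t < s by [].
rewrite !mxE xyi ler_pM2l ?invr_gt0 ?subr_gt0// lerD2r.
exact: (mono t0 Cx Cy xy (ltW ts)).
Unshelve. all: by end_near. Qed.

(** For [i != j], the states [x] and [x + h *: delta_mx j 0] are ordered with equal [i]-th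
    coordinates, so Kamke's condition signs the difference quotient. *)
Lemma monotone_Jac_metzler t x : 0 <= t -> C x -> metzler (Jac (f t) x).
Proof.
(* The sign is reversed because [core_point_dense] propagates upper bounds. *)
move=> t0 Cx i j ij; rewrite -oppr_le0.
have cJ : continuous (Jac (f t)) by have [] := hf.2 t t0.
have cq : continuous (fun A : 'M[R]_n => - A i j).
  move=> A; apply: (@continuous_comp _ _ _ (fun A : 'M[R]_n => A i j) (@GRing.opp R)).
    exact: (@coord_continuous R n n i j A).
  exact: opp_continuous.
apply: (core_point_dense cC iC cJ cq) Cx => {}x core; rewrite oppr_le0.
have cz := @Jac_quot_right t x (delta_mx j 0) t0.
have colj : (Jac (f t) x *m (delta_mx j 0 : 'cV[R]_n)) i 0 = Jac (f t) x i j by rewrite -colE mxE.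
have : (h^-1 *: (f t (x + h *: delta_mx j 0) - f t x)) i 0 @[h --> 0^'+] -->
    Jac (f t) x i j.
  rewrite -colj; exact: (@cvg_comp _ _ _
    (fun h : R => h^-1 *: (f t (x + h *: delta_mx j 0) - f t x))
    (fun M : 'cV[R]_n => M i 0) (0^'+) _ _ cz
    (@coord_continuous R n 1 i 0 (Jac (f t) x *m delta_mx j 0))).
move=> ci.
have corej := core (delta_mx j 0).
apply: cvgr_to_ge ci _; near=> h; have h0 : 0 < h by [].
have Ch : C (x + h *: delta_mx j 0) by near: h.
rewrite !mxE mulr_ge0 ?invr_ge0 ?(ltW h0)// subr_ge0.
apply: monotone_field_le => //; first exact: core_point_sub.
  by move=> k; rewrite !mxE lerDl mulr_ge0 ?(ltW h0)// ler0n.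
by rewrite !mxE (negbTE ij) mulr0 addr0.
Unshelve. all: by end_near. Qed.

(** * Equivalences and contraction estimates for the flow *)

Variables (N : 'cV[R]_n -> R) (W : 'cV[R]_n -> 'cV[R]_n -> R) (b : R).
Hypotheses (hN : is_norm N) (hW : is_weak_pairing W) (NW : wp_associated N W)
  (hD : deimling N W).

Lemma segment_wp_bound t x y : 0 <= t -> C x -> C y ->
  (forall z, C z -> W (Jac (f t) z *m (x - y)) (x - y) <= b * N (x - y) ^+ 2) ->
  W (f t x - f t y) (x - y) <= b * N (x - y) ^+ 2.
Proof.
move=> t0 Cx Cy Jb; rewrite -{1}[x](subrKC y).
apply: (wp_mean_value hW); first exact: field_differentiable.
move=> s s0 s1; apply: Jb.
rewrite (_ : y + _ = s *: x + (1 - s) *: y); first exact: convex_set_comb.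
by rewrite scalerBr scalerBl scale1r addrCA.
Qed.

Lemma conic_measure_weak_pairing : (0 < n)%N ->
  conic_measure_bound N f C b <-> weak_pairing_bound N W f C b.
Proof.
move=> n0; split=> [mub t x y t0 Cx Cy yx|Wb t x t0 Cx].
  apply: segment_wp_bound => // z Cz; apply: wp_le_conic => //; first exact: mub.
  by move=> i; rewrite !mxE subr_ge0.
apply: (conic_measure_le hN hW NW) => //; first exact: monotone_Jac_metzler.
by move=> v v0; apply: conic_wp_bound Wb _ _ _.
Qed.

Lemma contraction_weak_pairing :
  (forall t0 s t x0 y0, 0 <= t0 -> t0 <= s -> s <= t -> C x0 -> C y0 ->
     N (phi t t0 x0 - phi t t0 y0)
       <= expR (b * (t - s)) * N (phi s t0 x0 - phi s t0 y0)) ->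
  weak_pairing_bound N W f C b.
Proof.
move=> ctr t x y t0 Cx Cy _.
have [sx _] := hphi t0 Cx; have [sy _] := hphi t0 Cy.
apply: (wp_le_of_contraction hN hD sx sy) => s ts.
by have := ctr t t s x y t0 (lexx _) ts Cx Cy; rewrite !(@flow_start t).
Qed.

Lemma monotonic_contraction : monotonic_norm N -> conic_measure_bound N f C b ->
  forall t0 s t x0 y0, 0 <= t0 -> t0 <= s -> s <= t -> C x0 -> C y0 ->
     N (phi t t0 x0 - phi t t0 y0)
       <= expR (b * (t - s)) * N (phi s t0 x0 - phi s t0 y0).
Proof.
move=> mN mub t0 s t x y t00 t0s st Cx Cy.
have [sx _] := hphi t00 Cx; have [sy _] := hphi t00 Cy.
apply: (wp_solution_contraction hN hW NW sx sy) => // r t0r.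
have r0 := le_trans t00 t0r.
apply: segment_wp_bound => //; [exact: invC|exact: invC|] => z Cz.
apply: (wp_le_conic_monotonic hN hW hD) => //; first exact: monotone_Jac_metzler.
exact: mub.
Qed.

(** Monotonicity keeps the two trajectories ordered, so the pairing bound for ordered pairs is
    available at every later time. *)
Lemma ordered_contraction : weak_pairing_bound N W f C b ->
  forall t0 t x0 y0, 0 <= t0 -> t0 <= t -> C x0 -> C y0 -> vle y0 x0 ->
     N (phi t t0 x0 - phi t t0 y0) <= expR (b * (t - t0)) * N (x0 - y0).
Proof.
move=> Wb t0 t x y t00 t0t Cx Cy yx.
have [sx _] := hphi t00 Cx; have [sy _] := hphi t00 Cy.
have := wp_solution_contraction hN hW NW sx sy _ (lexx t0) t0t.
rewrite !flow_start//; apply => r t0r; apply: Wb; [exact: le_trans t0r|exact: invC|exact: invC|].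
exact: mono.
Qed.

(* Both trajectories dominate the one issued at time [s] from the entrywise
   minimum of their positions. *)
Lemma box_contraction xmin xmax : C = vbox xmin xmax -> weak_pairing_bound N W f C b ->
  exists2 M : R, 0 < M &
    forall t0 s t x0 y0, 0 <= t0 -> t0 <= s -> s <= t -> C x0 -> C y0 ->
      N (phi t t0 x0 - phi t t0 y0)
        <= M * expR (b * (t - s)) * N (phi s t0 x0 - phi s t0 y0).
Proof.
move=> CE Wb; have [K1 K10 NK1] := norm_le_mx_norm hN; have [K2 K20 NK2] := mx_norm_le_norm hN.
(* [K1 * K2] is the cost of passing from [N] to the sup norm and back; 2 counts the two legs through
   the trajectory of the minimum. *)
exists (2 * (K1 * K2)); first by rewrite !mulr_gt0.
move=> t0 s t x0 y0 t00 t0s st Cx0 Cy0; have s0 := le_trans t00 t0s.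
(* Restarting at time [s] makes the current positions initial states, as [z] will be. *)
rewrite -(flow_restart t00 t0s st Cx0) -(flow_restart t00 t0s st Cy0).
have := invC t00 t0s Cy0; have := invC t00 t0s Cx0.
move: (phi s t0 x0) (phi s t0 y0) => x y Cx Cy.
pose z : 'cV[R]_n := \col_i Num.min (x i 0) (y i 0).
have Cz : C z.
  move: Cx Cy; rewrite CE => -[x1 x2] [y1 y2]; split=> i; rewrite mxE.
    by rewrite le_min x1 y1.
  by rewrite ge_min x2.
have zx : vle z x by move=> i; rewrite mxE ge_min lexx.
have zy : vle z y by move=> i; rewrite mxE ge_min lexx orbT.
(* Each coordinate of [u - z] is 0 or [|x i 0 - y i 0|], so the sup norm of [u - z] is at most that
   of [x - y]. *)
have close u : (u = x \/ u = y) -> N (u - z) <= K1 * K2 * N (x - y).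
  move=> uxy; apply: le_trans (NK1 _) _; rewrite -mulrA ler_pM2l//.
  apply: le_trans (NK2 _); apply: norm_le_coord => // i.
  apply: le_trans (coord_le_norm (x - y) i 0); rewrite !mxE.
  by case: uxy => ->; case: (leP (x i 0)) => // _; rewrite ?subrr ?normr0// distrC.
have ctr u : C u -> (u = x \/ u = y) -> vle z u ->
    N (phi t s u - phi t s z) <= expR (b * (t - s)) * (K1 * K2 * N (x - y)).
  move=> Cu uxy zu; apply: le_trans (ordered_contraction Wb s0 st Cu Cz zu) _.
  by rewrite ler_pM2l ?expR_gt0// close.
rewrite -(subrKA (phi t s z)) (le_trans (norm_triangle hN _ _))//.
rewrite (norm_subC hN (phi t s z)).
have := ctr x Cx (or_introl erefl) zx; have := ctr y Cy (or_intror erefl) zy.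
lra.
Qed.

End Flow.

Theorem mainTheorem3 (R : realType) (n : nat) (n_gt0 : (0 < n)%N)
    (f : R -> 'cV[R]_n -> 'cV[R]_n) (phi : R -> R -> 'cV[R]_n -> 'cV[R]_n)
    (C : set 'cV[R]_n) (N : 'cV[R]_n -> R) (W : 'cV[R]_n -> 'cV[R]_n -> R)
    (b : R) :
  regular_field f ->
  convex_set C ->
  C° !=set0 ->
  is_flow f C phi ->
  forward_invariant C phi ->
  monotone_on C phi ->
  is_norm N ->
  is_weak_pairing W ->
  wp_associated N W ->
  deimling N W ->
  (monotonic_norm N ->
     (conic_measure_bound N f C b <-> weak_pairing_bound N W f C b) /\
     (weak_pairing_bound N W f C b <->
        forall t0 s t x0 y0, 0 <= t0 -> t0 <= s -> s <= t -> C x0 -> C y0 ->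
          N (phi t t0 x0 - phi t t0 y0)
            <= expR (b * (t - s)) * N (phi s t0 x0 - phi s t0 y0))) /\
  (~ monotonic_norm N ->
     (conic_measure_bound N f C b <-> weak_pairing_bound N W f C b) /\
     forall xmin xmax : 'cV[R]_n, vlt xmin xmax -> C = vbox xmin xmax ->
       conic_measure_bound N f C b \/ weak_pairing_bound N W f C b ->
       exists2 M : R, 0 < M &
         forall t0 s t x0 y0, 0 <= t0 -> t0 <= s -> s <= t ->
           vbox xmin xmax x0 -> vbox xmin xmax y0 ->
           N (phi t t0 x0 - phi t t0 y0)
             <= M * expR (b * (t - s)) * N (phi s t0 x0 - phi s t0 y0)).
Proof.
move=> hf cC iC hphi invC mono hN hW NW hD.
have equiv := conic_measure_weak_pairing hf cC iC hphi mono b hN hW NW hD n_gt0.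
split=> [mN|_].
  split; first exact: equiv.
  split=> [/equiv mub|]; first exact: (monotonic_contraction hf cC iC hphi invC mono hN hW NW hD).
  exact: (contraction_weak_pairing hphi).
split; first exact: equiv.
move=> xmin xmax _ CE mub; have Wb : weak_pairing_bound N W f C b by case: mub => // /equiv.
by rewrite -CE; exact: (box_contraction hphi invC mono hN hW NW CE Wb).
Qed.
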